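(* Let $f \in \mathbb{Z}[X]$ be monic irreducible cubic, with discriminant of the form $\pm 3^k$ with $k \in \mathbb{Z}_{\geq 0}$. Assume that $f$ has a zero of multiplicity $3$ modulo $3$, and that $f$ does not have a triple zero modulo $27$. Also assume that if the $\mathbb{Z}$-rank of $f$ is $6$, then $f$ does not have a triple zero modulo $9$. Then $f$ is equivalent to one of the polynomials $$X^3 - 3, \qquad X^3 - 3X + 1, \qquad X^3 - 9X + 9.$$
   Context: Two polynomials $f,g \in \mathbb{Z}[X]$ are called equivalent if there exist ring homomorphisms $\mathbb{Z}[X]/(f) \to \mathbb{Z}[X]/(g)$ and $\mathbb{Z}[X]/(g) \to \mathbb{Z}[X]/(f)$. A monic cubic $f$ has a triple zero modulo an integer $m$ if $f \equiv (X-a)^3 \bmod m$ for some $a \in \mathbb{Z}$. $\mathbb{Z}$-rank: for $f \in \mathbb{Z}[X]$ monic of degree $n$, put $A_0 = \mathbb{Z}$, $f_0 = f$ and recursively for $0 \le i < n$ put $A_{i+1} = A_i[X_{i+1}]/(f_i(X_{i+1}))$, $\alpha_{i+1} = \overline{X_{i+1}} \in A_{i+1}$ and $f_{i+1}(X) = f_i(X)/(X-\alpha_{i+1}) \in A_{i+1}[X]$. For $f$ monic irreducible cubic, the $\mathbb{Z}$-rank of $f$ is the rank (as a free $\mathbb{Z}$-module) of the smallest $A_i$ which contains three zeroes of $f$. (Thus it is $6$ if $f_1$ is irreducible over $A_1 = \mathbb{Z}[X]/(f)$, and $3$ otherwise.) *)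

(* Defs.v *)
From HB Require Import structures.
From mathcomp Require Import all_boot all_order all_algebra.
From mathcomp Require Import qpoly.

Set Implicit Arguments.
Unset Strict Implicit.
Unset Printing Implicit Defensive.

Import Order.TTheory GRing.Theory Num.Theory.
Local Open Scope ring_scope.

(* Irreducibility as an element of the ring R.  The library's                 *)
(* [irreducible_poly] is based on pseudo-division, so over [int] it describes *)
(* irreducibility over the fraction field instead.                            *)
Definition irreducible_elt (R : unitRingType) (x : R) : Prop :=
  [/\ x != 0, x \isn't a GRing.unit &
      forall y z : R, x = y * z -> y \is a GRing.unit \/ z \is a GRing.unit].

(* [{poly %/ f}] is Z[X]/(f) when f is monic of positive degree (for any      *)
(* other f the library substitutes 'X for f).  All polynomials to which the   *)
(* definitions below are applied are monic of positive degree.                *)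
Definition poly_equivalent (f g : {poly int}) : Prop :=
  inhabited {rmorphism {poly %/ f} -> {poly %/ g}} /\
  inhabited {rmorphism {poly %/ g} -> {poly %/ f}}.

(* The discriminant of a monic f of degree n: (-1)^(n(n-1)/2) Res(f, f').     *)
Definition discriminant (f : {poly int}) : int :=
  (-1) ^+ 'C((size f).-1, 2) * resultant f f^`().

Definition triple_zero_mod (f : {poly int}) (m : int) : Prop :=
  exists a : int, forall i : nat,
    (f`_i = (('X - a%:P) ^+ 3)`_i %[mod m])%Z.

Record tower_stage : Type := TowerStage {
  stage_ring : comNzRingType;
  stage_poly : {poly stage_ring}
}.

(* From (A_i, f_i) to (A_{i+1}, f_{i+1}): here ['qX] is alpha_{i+1} and       *)
(* [rdivp] is exact division by the monic polynomial X - alpha_{i+1}.         *)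
Definition next_stage (s : tower_stage) : tower_stage :=
  let: TowerStage A f := s in
  @TowerStage {poly %/ f}
    (Pdiv.Ring.rdivp (map_poly (qpolyC f) f) ('X - ('qX : {poly %/ f})%:P)).

(* The pair (A_i, f_i); meaningful for i at most the degree of f.             *)
Definition tower (f : {poly int}) (i : nat) : tower_stage :=
  iter i next_stage (@TowerStage int f).

Definition contains_three_zeroes (A : comNzRingType) (f : {poly int}) : Prop :=
  exists a b c : A,
    uniq [:: a; b; c] /\ all (root (map_poly intr f)) [:: a; b; c].

Definition free_of_rank (A : zmodType) (r : nat) : Prop :=
  exists e : 'I_r -> A,
    bijective (fun c : 'rV[int]_r => \sum_(j < r) e j *~ c 0 j).

(* [Z_rank f r]: r is the Z-rank of the monic irreducible cubic f.            *)
Definition Z_rank (f : {poly int}) (r : nat) : Prop :=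
  exists i : nat,
    [/\ (i <= (size f).-1)%N,
        contains_three_zeroes (stage_ring (tower f i)) f,
        forall j : nat, (j < i)%N ->
          ~ contains_three_zeroes (stage_ring (tower f j)) f
      & free_of_rank (stage_ring (tower f i)) r].

(* Main.v *)
From HB Require Import structures.
Require Import Defs.
From mathcomp Require Import all_boot all_order all_algebra.
From mathcomp Require Import qpoly.
From mathcomp Require Import ring lra zify.

Set Implicit Arguments.
Unset Strict Implicit.
Unset Printing Implicit Defensive.

Import Order.TTheory GRing.Theory Num.Theory.
Local Open Scope ring_scope.

(**
A cubic that is a cube modulo 3 can be translated to the depressed form
X^3 + 3 p X + q, whose discriminant is -27 (q^2 + 4 p^3); hence the hypothesis
on the discriminant says that q^2 + 4 p^3 = e 3^m with e = 1 or e = -1.  One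
could solve this equation for all p, q, m, but that leads to Thue equations
such as x^3 - 3 x y^2 + y^3 = 1 that are hard to solve.  It is enough to
parametrise the solutions, because the parameters of a solution are exactly
what is needed to write down the equivalence.

The equivalences come from the classical covariants of a binary cubic form.
Let t be a root of g = X^3 + 3 u X + v.  For integers x and y, the element
x t + y (t^2 + 2 u) of Z[t] is a root of X^3 + 3 H X + Q, where H and Q are
the Hessian and the Jacobian covariant of the form
F = x^3 + 3 u x y^2 + v y^3, evaluated at (x, y) ([covariant_root]).  The
index in Z[t] of the subring that this element generates is |F(x, y)|, so if
F(x, y) is 1 or -1, the two cubics are equivalent ([covariant_equivalent]).
The three target cubics belong to the forms x^3 - 3 y^3,
x^3 - 3 x y^2 + y^3 and x^3 - 9 x y^2 + 9 y^3.

If e = 1, then m is even, as one sees modulo 4, and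
(q - 3^(m/2)) (q + 3^(m/2)) = -4 p^3 is a factorisation over Z, in which two
coprime factors have to be cubes.  Either X^3 + 3 p X + q has an integer
root, by Cardano's formula, or (p, q) comes from the form x^3 - 3 y^3 at a
point where it is a unit, or 3 | p and 9 | q ([sqr_plus_cube_eq_pow3]).  The
last case means that f has a triple zero modulo 9.  As the discriminant of f
is negative here, so is its norm from Z[X]/(f), which is its cube, and it is
not a square in that ring.  Hence f does not split there, the Z-rank is 6
([Z_rank_6_of_disc_lt0]), and this case is excluded.

If e = -1, then m is odd and q^2 + 3 (3^((m-1)/2))^2 = 4 (-p)^3 is a
factorisation of a cube in the ring of Eisenstein integers.  Since this ring
has Bezout identities, each factor is a unit times a cube
([four_cubes_norm]).  If the unit is 1 or -1, there is an integer root, or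
a contradiction modulo 2 when 3 | q.  Otherwise, up to a linear change, the
coordinates of the cube root are the parameters x, y of the form
x^3 - 3 x y^2 + y^3 or, when 3 | q, of x^3 - 9 x y^2 + 9 y^3, and the
condition modulo 27 bounds m so that the form takes a unit value
([sqr_plus_cube_eq_opp_pow3]).
*)

(** * Coprime factors of a cube *)

Definition bezout_ring (A : comNzRingType) : Prop :=
  forall x y : A, exists g u v r s : A,
    [/\ g = u * x + v * y, x = r * g & y = s * g].

(** Let g generate the ideal (r, b).  Then g^3 lies in (r^3, r^2 b, r b^2, b^3),
which is contained in (b).  Conversely, b = b (x b + y c)^2 lies in
(b^3, b c) = (b^3, r^3), which is contained in (g^3).  In a domain, e and e'
are therefore inverse units if b is not 0. *)
Lemma comaximal_product_cube (A : comNzRingType) (b c r : A) :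
    bezout_ring A -> (exists x y, x * b + y * c = 1) -> b * c = r ^+ 3 ->
  exists g e e' : A, b = e * g ^+ 3 /\ g ^+ 3 = e' * b.
Proof.
move=> bezA [x [y xy1]] bc; have [g [u [v [k [l [gE rE bE]]]]]] := bezA r b.
exists g, (x ^+ 2 * l ^+ 3 + (2 * x * y * b + y ^+ 2 * c) * k ^+ 3),
  (u ^+ 3 * c + 3 * u ^+ 2 * v * r ^+ 2 + 3 * u * v ^+ 2 * r * b
   + v ^+ 3 * b ^+ 2); split.
- transitivity (x ^+ 2 * b ^+ 3 + (2 * x * y * b + y ^+ 2 * c) * r ^+ 3).
    have bE1 : b * (x * b + y * c) ^+ 2 = b by rewrite xy1 expr1n mulr1.
    by rewrite -bc -[LHS]bE1; ring.
  have -> : b ^+ 3 = l ^+ 3 * g ^+ 3 by rewrite [in LHS]bE exprMn.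
  have -> : r ^+ 3 = k ^+ 3 * g ^+ 3 by rewrite [in LHS]rE exprMn.
  by ring.
- by rewrite [in LHS]gE; ring: bc.
Qed.

Lemma int_bezout : bezout_ring int.
Proof.
move=> x y; have [u [v uv]] := Bezoutz x y.
have /dvdzP[r rE] := dvdz_gcdl x y; have /dvdzP[s sE] := dvdz_gcdr x y.
by exists (gcdz x y), u, v, r, s.
Qed.

Lemma int_comaximal_product_cube (b c r : int) :
  coprimez b c -> b * c = r ^+ 3 -> exists x, b = x ^+ 3.
Proof.
move=> /coprimezP[[x y] /= xy1] bc.
have [|g [e [e' [bE gE]]]] := comaximal_product_cube int_bezout _ bc.
  by exists x, y.
have [->|b0] := eqVneq b 0; first by exists 0; rewrite expr0n.
have e1 : e' * e = 1.
  by apply: (mulIf b0); rewrite mul1r [RHS]bE gE; ring.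
have /orP[/eqP eE|/eqP eE] := intUnitRing.unitzPl e1; rewrite eE in bE.
- by exists g; rewrite bE mul1r.
- by exists (- g); rewrite bE; ring.
Qed.

Lemma int_cube_inj (x y : int) : x ^+ 3 = y ^+ 3 -> x = y.
Proof.
move=> xy; have : (x - y) * ((2 * x + y) ^+ 2 + 3 * y ^+ 2) = 0.
  by transitivity (4 * (x ^+ 3 - y ^+ 3)); [ring | rewrite xy subrr].
move/eqP; rewrite mulf_eq0 subr_eq0 => /orP[/eqP //|].
move=> /eqP N0; have := sqr_ge0 (2 * x + y); have := sqr_ge0 y => y_ge xy_ge.
have : y ^+ 2 == 0 by apply/eqP; lia.
have : (2 * x + y) ^+ 2 == 0 by apply/eqP; lia.
by rewrite !sqrf_eq0 => /eqP ? /eqP ?; lia.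
Qed.

(** * The Eisenstein integers *)

(** [Eisenstein a b] is a + b w, where w is a primitive cube root of unity. *)
Record eisenstein := Eisenstein { eis_re : int; eis_om : int }.

Definition eis_pair (x : eisenstein) := (eis_re x, eis_om x).
Definition pair_eis p := Eisenstein p.1 p.2.
Lemma eis_pairK : cancel eis_pair pair_eis. Proof. by case. Qed.

HB.instance Definition _ := Choice.copy eisenstein (can_type eis_pairK).

Definition eis_add x y :=
  Eisenstein (eis_re x + eis_re y) (eis_om x + eis_om y).
Definition eis_opp x := Eisenstein (- eis_re x) (- eis_om x).
Definition eis_mul x y :=
  Eisenstein (eis_re x * eis_re y - eis_om x * eis_om y)
    (eis_re x * eis_om y + eis_om x * eis_re y - eis_om x * eis_om y).

Lemma eis_addA : associative eis_add.
Proof. by move=> [a b] [c d] [e f]; congr Eisenstein => /=; ring. Qed.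
Lemma eis_addC : commutative eis_add.
Proof. by move=> [a b] [c d]; congr Eisenstein => /=; ring. Qed.
Lemma eis_add0 : left_id (Eisenstein 0 0) eis_add.
Proof. by move=> [a b]; congr Eisenstein => /=; ring. Qed.
Lemma eis_addN : left_inverse (Eisenstein 0 0) eis_opp eis_add.
Proof. by move=> [a b]; congr Eisenstein => /=; ring. Qed.

HB.instance Definition _ :=
  GRing.isZmodule.Build eisenstein eis_addA eis_addC eis_add0 eis_addN.

Lemma eis_mulA : associative eis_mul.
Proof. by move=> [a b] [c d] [e f]; congr Eisenstein => /=; ring. Qed.
Lemma eis_mulC : commutative eis_mul.
Proof. by move=> [a b] [c d]; congr Eisenstein => /=; ring. Qed.
Lemma eis_mul1 : left_id (Eisenstein 1 0) eis_mul.
Proof. by move=> [a b]; congr Eisenstein => /=; ring. Qed.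
Lemma eis_mulD : left_distributive eis_mul +%R.
Proof. by move=> [a b] [c d] [e f]; congr Eisenstein => /=; ring. Qed.
Lemma eis_nonzero1 : Eisenstein 1 0 != 0.
Proof. by apply/eqP => -[]. Qed.

HB.instance Definition _ :=
  GRing.Zmodule_isComNzRing.Build eisenstein
    eis_mulA eis_mulC eis_mul1 eis_mulD eis_nonzero1.

Definition eis_conj x := Eisenstein (eis_re x - eis_om x) (- eis_om x).
Definition eis_norm x : int :=
  eis_re x ^+ 2 - eis_re x * eis_om x + eis_om x ^+ 2.

Lemma eis_normM x y : eis_norm (x * y) = eis_norm x * eis_norm y.
Proof. by case: x y => [a b] [c d]; rewrite /eis_norm /=; ring. Qed.

Lemma eis_mulE (a b c d : int) :
  Eisenstein a b * Eisenstein c d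
  = Eisenstein (a * c - b * d) (a * d + b * c - b * d).
Proof. by []. Qed.

Lemma eis_norm_ge0 x : 0 <= eis_norm x.
Proof.
have := sqr_ge0 (2 * eis_re x - eis_om x); have := sqr_ge0 (eis_om x).
by rewrite /eis_norm; nra.
Qed.

Lemma eis_norm_eq0 x : eis_norm x = 0 -> x = 0.
Proof.
case: x => a b; rewrite /eis_norm /= => N0.
have b0 : b = 0.
  by apply/eqP; rewrite -sqrf_eq0; apply/eqP; have := sqr_ge0 (2 * a - b); nra.
have a0 : a = 0.
  by apply/eqP; rewrite -sqrf_eq0 -N0 b0; apply/eqP; ring.
by rewrite a0 b0.
Qed.

Lemma int_round (c n : int) : 0 < n -> exists q, -n <= 2 * (c - q * n) <= n.
Proof.
move=> n0; exists ((2 * c + n) %/ (2 * n))%Z.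
have := divz_eq (2 * c + n) (2 * n).
have := modz_ge0 (2 * c + n) (_ : 2 * n != 0).
have := ltz_pmod (2 * c + n) (_ : 0 < 2 * n).
set q := (_ %/ _)%Z; set r := (_ %% _)%Z; nia.
Qed.

(** Rounding both coordinates of x / y leaves a remainder c + d w of x / y with
|c|, |d| <= 1/2, whose norm c^2 - c d + d^2 is at most 3/4. *)
Lemma eis_division x y : y != 0 ->
  exists q, eis_norm (x - q * y) < eis_norm y.
Proof.
move=> y0; have ny : 0 < eis_norm y.
  rewrite lt_neqAle eis_norm_ge0 andbT eq_sym.
  by apply: contra y0 => /eqP/eis_norm_eq0->.
pose z := x * eis_conj y.
have [c cP] := int_round (eis_re z) ny; have [d dP] := int_round (eis_om z) ny.
exists (Eisenstein c d); set n := eis_norm y in ny cP dP *.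
rewrite -(ltr_pM2r ny).
have -> : eis_norm (x - Eisenstein c d * y) * n =
  (eis_re z - c * n) ^+ 2 - (eis_re z - c * n) * (eis_om z - d * n)
  + (eis_om z - d * n) ^+ 2.
  rewrite /z /n /eis_norm.
  by case: x y {y0 z n ny cP dP} => [x1 x2] [y1 y2] /=; ring.
nra.
Qed.

Lemma eis_bezout : bezout_ring eisenstein.
Proof.
move=> x y; have [n] := ubnP `|eis_norm y|%N.
elim: n => // n IHn in x y *; rewrite ltnS => le_y.
have [->|y0] := eqVneq y 0.
  by exists x, 1, 0, 1, 0; split; ring.
have [q qP] := eis_division x y0.
have [|g [u [v [r [s [gE yE xE]]]]]] := IHn y (x - q * y).
  apply: leq_trans le_y.
  by rewrite -ltz_nat !gez0_abs ?eis_norm_ge0.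
exists g, v, (u - v * q), (s + q * r), r; split => //.
  by rewrite gE; ring.
by rewrite -[x](subrK (q * y)) xE yE; ring.
Qed.

Lemma eis_norm1P e : eis_norm e = 1 ->
  exists2 d : int, d = 1 \/ d = -1 &
    [\/ e = Eisenstein d 0, e = Eisenstein 0 d | e = Eisenstein d d].
Proof.
case: e => a b; rewrite /eis_norm /= => N1.
have a1 : -1 <= a <= 1 by have := sqr_ge0 (2 * b - a); nia.
have b1 : -1 <= b <= 1 by have := sqr_ge0 (2 * a - b); nia.
have [aE|[aE|aE]] : a = -1 \/ a = 0 \/ a = 1 by lia.
all: have [bE|[bE|bE]] : b = -1 \/ b = 0 \/ b = 1 by lia.
all: move: N1; rewrite aE bE // => _.
all: first
  [ by exists 1; [left | apply: Or31] | by exists 1; [left | apply: Or32]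
  | by exists 1; [left | apply: Or33] | by exists (-1); [right | apply: Or31]
  | by exists (-1); [right | apply: Or32]
  | by exists (-1); [right | apply: Or33] ].
Qed.

(** The number h + s w with 2 h = q + s has trace q and norm r^3, and the
coprimality of q and r makes it coprime to its conjugate.  So it is a unit
times (a + b w)^3.  The first case of the conclusion is the one where the unit
is 1 or -1, and q is then the trace of (a + b w)^3; up to sign, the units
w and w^2 are the second case, and they differ by conjugation, that is by
swapping a and b and changing the sign of s. *)
Lemma four_cubes_norm (q s r : int) :
    q ^+ 2 + 3 * s ^+ 2 = 4 * r ^+ 3 -> coprimez q r ->
  exists a b : int, r = a ^+ 2 - a * b + b ^+ 2 /\
    (q = (a + b) * (2 * a - b) * (a - 2 * b) \/
     q = - (a ^+ 3 + 3 * a ^+ 2 * b - 6 * a * b ^+ 2 + b ^+ 3) /\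
     (s = a ^+ 3 - 3 * a ^+ 2 * b + b ^+ 3 \/
      s = - (a ^+ 3 - 3 * a ^+ 2 * b + b ^+ 3))).
Proof.
move=> qsr qr.
have [h qE] : exists h, q = 2 * h - s.
  by exists ((q + s) %/ 2)%Z; nia.
pose b := Eisenstein h s; pose c := eis_conj b.
have rE : h ^+ 2 - h * s + s ^+ 2 = r ^+ 3 by nia.
pose R := Eisenstein r 0.
have bcR : b * c = R ^+ 3.
  rewrite exprS expr2 /R /b /c !eis_mulE /=; congr Eisenstein; last by ring.
  by transitivity (r ^+ 3); [rewrite -rE; ring | ring].
have [g [e [e' [bE gE]]]] :
    exists g e e' : eisenstein, b = e * g ^+ 3 /\ g ^+ 3 = e' * b.
  apply: (comaximal_product_cube eis_bezout _ bcR).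
  have /coprimezP[[x y] /= xy1] : coprimez q (r ^+ 3) by rewrite coprimezXr.
  exists (Eisenstein (x + y * (h - s)) (- y * s)), (Eisenstein x 0).
  rewrite !eis_mulE; congr Eisenstein => /=.
    by rewrite -xy1 -rE qE; ring.
  by ring.
have r0 : r ^+ 3 != 0.
  rewrite expf_neq0 //; apply: contraTneq qr => r0; rewrite r0 /coprimez gcdz0.
  by apply/eqP => q1; move: qsr; rewrite r0; have := sqr_ge0 s; nia.
have normb : eis_norm b = r ^+ 3 by [].
have norm_bE : r ^+ 3 = eis_norm e * eis_norm (g ^+ 3).
  by rewrite -eis_normM -bE normb.
have norm_gE : eis_norm (g ^+ 3) = eis_norm e' * r ^+ 3.
  by rewrite gE eis_normM normb.
have norm_e : eis_norm e = 1.
  have ee' : eis_norm e' * eis_norm e = 1.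
    by apply: (mulIf r0); rewrite mul1r [RHS]norm_bE norm_gE; ring.
  have := eis_norm_ge0 e.
  by have /orP[/eqP-> //|/eqP->] := intUnitRing.unitzPl ee'.
have rgE : r = eis_norm g.
  by apply: int_cube_inj; rewrite norm_bE norm_e mul1r !exprS !eis_normM; ring.
case: g rgE bE {gE norm_bE norm_gE} => x y -> /=.
rewrite exprS expr2 !eis_mulE.
have [d dE [] ->] := eis_norm1P norm_e; rewrite eis_mulE => -[hE sE].
- exists (d * x), (d * y);
  split; first by case: dE => ->; rewrite /eis_norm /=; ring.
  by left; case: dE qE hE sE => -> -> -> ->; ring.
- exists (d * x), (d * y);
  split; first by case: dE => ->; rewrite /eis_norm /=; ring.
  right; split; first by case: dE qE hE sE => -> -> -> ->; ring.
  by left; case: dE sE => -> ->; ring.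
- exists (- d * y), (- d * x);
  split; first by case: dE => ->; rewrite /eis_norm /=; ring.
  right; split; first by case: dE qE hE sE => -> -> -> ->; ring.
  by right; case: dE sE => -> ->; ring.
Qed.

(** * Homomorphisms out of Z[X]/(f) *)

Lemma mk_monicE (A : nzRingType) (h : {poly A}) :
  (1 < size h)%N -> h \is monic -> mk_monic h = h.
Proof. by rewrite /mk_monic => -> ->. Qed.

Lemma poly_of_qpolyM_divE (A : comNzRingType) (h : {poly A})
    (x y : {poly %/ h}) :
    (1 < size h)%N -> h \is monic ->
  exists k, (x : {poly A}) * y = k * h + (x * y : {poly %/ h}).
Proof.
move=> h_gt1 h_monic; rewrite poly_of_qpolyM.
move: (_ * _ : {poly A}) => xy; rewrite mk_monicE //.
by exists (Pdiv.Ring.rdivp xy h); apply: Pdiv.RingMonic.rdivp_eq.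
Qed.

(** The universal property of Z[X]/(f). *)
Lemma qpoly_hom_of_root (f : {poly int}) (B : comNzRingType) (b : B) :
    (1 < size f)%N -> f \is monic -> root (map_poly intr f) b ->
  inhabited {rmorphism {poly %/ f} -> B}.
Proof.
move=> f_gt1 f_monic /rootP fb0.
pose ev (p : {poly %/ f}) : B := (map_poly intr (p : {poly int})).[b].
have evB : zmod_morphism ev.
  move=> p q; rewrite /ev.
  have -> : (p - q : {poly %/ f}) = (p : {poly int}) - q :> {poly int} by [].
  by rewrite rmorphB hornerD hornerN.
have evM : monoid_morphism ev.
  split=> [|p q]; first by rewrite /ev /= rmorph1 hornerC.
  have [k pqE] := poly_of_qpolyM_divE p q f_gt1 f_monic.
  rewrite /ev -hornerM -rmorphM pqE.
  by rewrite rmorphD rmorphM hornerD hornerM fb0 mulr0 add0r.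
pose ev_zmod := GRing.isZmodMorphism.Build _ _ ev evB.
pose ev_mon := GRing.isMonoidMorphism.Build _ _ ev evM.
pose phi : {rmorphism {poly %/ f} -> B} := HB.pack ev ev_zmod ev_mon.
exact: (inhabits phi).
Qed.

Lemma root_qpolyX (A : comNzRingType) (h : {poly A}) :
    (1 < size h)%N -> h \is monic ->
  root (map_poly (qpolyC h) h) ('qX : {poly %/ h}).
Proof.
move=> h_gt1 h_monic; apply/rootP.
have -> : map_poly (qpolyC h) h = map_poly (in_qpoly h \o polyC) h.
  apply: eq_map_poly => z; apply: val_inj => /=.
  rewrite Pdiv.Ring.rmodp_small // mk_monicE // size_polyC.
  by apply: leq_ltn_trans h_gt1; case: (z != 0).
rewrite map_poly_comp horner_map /= -/(comp_poly 'X h) comp_polyXr.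
apply: val_inj; rewrite /= mk_monicE //.
exact: Pdiv.RingMonic.rmodpp.
Qed.

Lemma map_poly_intr_qpolyC (A : comNzRingType) (h : {poly A}) (f : {poly int}) :
  map_poly intr f = map_poly (qpolyC h) (map_poly intr f).
Proof.
by rewrite -map_poly_comp; apply: eq_map_poly => z /=; rewrite rmorph_int.
Qed.

Lemma map_poly_intr_int (h f : {poly int}) :
  map_poly intr f = map_poly (qpolyC h) f.
Proof. by apply: eq_map_poly => z; rewrite -[in RHS](intz z) rmorph_int. Qed.

Lemma root_intr_qpolyX (f : {poly int}) :
    (1 < size f)%N -> f \is monic -> root (map_poly intr f) ('qX : {poly %/ f}).
Proof. by rewrite (map_poly_intr_int f); apply: root_qpolyX. Qed.

Lemma poly_equivalent_of_roots (f g : {poly int}) :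
    (1 < size f)%N -> f \is monic -> (1 < size g)%N -> g \is monic ->
    (exists b : {poly %/ g}, root (map_poly intr f) b) ->
    (exists b : {poly %/ f}, root (map_poly intr g) b) ->
  poly_equivalent f g.
Proof.
move=> f1 fm g1 gm [b fb] [c gc].
by split; [apply: qpoly_hom_of_root fb | apply: qpoly_hom_of_root gc].
Qed.

Lemma poly_equivalent_trans (f g h : {poly int}) :
  poly_equivalent f g -> poly_equivalent g h -> poly_equivalent f h.
Proof.
move=> [[fg] [gf]] [[gh] [hg]].
pose fh : {rmorphism {poly %/ f} -> {poly %/ h}} := gh \o fg.
pose hf : {rmorphism {poly %/ h} -> {poly %/ f}} := gf \o hg.
by split; [exact: inhabits fh | exact: inhabits hf].
Qed.

(** * Depressed cubics and their covariants *)

Definition depressed (p q : int) : {poly int} :=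
  'X^3 + (3 * p)%:P * 'X + q%:P.

Lemma depressedE p q : depressed p q = Poly [:: q; 3 * p; 0; 1].
Proof.
apply/polyP => i; rewrite /depressed.
rewrite !coefD coefXn coefCM coefX coefC coef_Poly.
by case: i => [|[|[|[|i]]]] /=; rewrite ?nth_nil; ring.
Qed.

Lemma size_depressed p q : size (depressed p q) = 4%N.
Proof. by rewrite depressedE (@PolyK _ 0). Qed.

Lemma depressed_monic p q : depressed p q \is monic.
Proof. by rewrite monicE lead_coefE size_depressed depressedE coef_Poly. Qed.

Lemma root_depressed (B : comNzRingType) (p q : int) (t : B) :
  root (map_poly intr (depressed p q)) t
  = (t ^+ 3 + 3 * p%:~R * t + q%:~R == 0).
Proof.
rewrite /root /depressed !rmorphD rmorphM /= !map_polyC map_polyXn map_polyX /=.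
by rewrite !hornerE; congr (_ == 0); ring.
Qed.

Lemma cubicE (f : {poly int}) :
  f \is monic -> size f = 4%N -> f = Poly [:: f`_0; f`_1; f`_2; 1].
Proof.
move=> fm f4; have f3 : f`_3 = 1 by move/monicP: fm; rewrite lead_coefE f4.
apply/polyP => i; rewrite coef_Poly; case: i => [|[|[|[|i]]]] //=.
by rewrite nth_nil nth_default // f4.
Qed.

(** Completing the cube: the substitution X -> X - b removes the quadratic
term. *)
Lemma root_depress (B : comNzRingType) (f : {poly int}) (b c : int) (t : B) :
    f \is monic -> size f = 4%N -> f`_2 = 3 * b -> f`_1 = 3 * c ->
  root (map_poly intr f) t =
  root (map_poly intr (depressed (c - b ^+ 2) (2 * b ^+ 3 - 3 * b * c + f`_0)))
       (t + b%:~R).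
Proof.
move=> fm f4 f2 f1; have := cubicE fm f4; rewrite f2 f1.
move: (f`_0) => d ->; rewrite root_depressed /root /=.
rewrite !cons_poly_def !(rmorphD, rmorphM) /= !map_polyC map_polyX /=.
rewrite !hornerE /=.
by congr (_ == 0); ring.
Qed.

Lemma depress_equivalent (f : {poly int}) (b c : int) :
    f \is monic -> size f = 4%N -> f`_2 = 3 * b -> f`_1 = 3 * c ->
  poly_equivalent f
    (depressed (c - b ^+ 2) (2 * b ^+ 3 - 3 * b * c + f`_0)).
Proof.
move=> fm f4 f2 f1; set g := depressed _ _.
have g4 : size g = 4%N := size_depressed _ _.
have gm : g \is monic := depressed_monic _ _.
apply: poly_equivalent_of_roots; rewrite ?f4 ?g4 //.
  exists ('qX - b%:~R); rewrite (root_depress _ fm f4 f2 f1) subrK.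
  by apply: root_intr_qpolyX; rewrite ?g4.
exists ('qX + b%:~R); rewrite -(root_depress _ fm f4 f2 f1).
by apply: root_intr_qpolyX; rewrite ?f4.
Qed.

(** The Hessian, divided by 36, of the form x^3 + 3 u x y^2 + v y^3. *)
Definition cubic_hessian (u v x y : int) :=
  u * x ^+ 2 + v * x * y - u ^+ 2 * y ^+ 2.

(** The Jacobian of the form and of [cubic_hessian], divided by 3. *)
Definition cubic_jacobian (u v x y : int) :=
  v * x ^+ 3 - 6 * u ^+ 2 * x ^+ 2 * y - 3 * u * v * x * y ^+ 2
      - (2 * u ^+ 3 + v ^+ 2) * y ^+ 3.

(** The elements x t + y (t^2 + 2 u) are exactly the elements of trace 0 in
Z[t], and the covariants give the coefficients of their characteristic
polynomials. *)
Lemma covariant_root (B : comNzRingType) (u v x y : int) (t : B) :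
  root (map_poly intr (depressed u v)) t ->
  root (map_poly intr (depressed (cubic_hessian u v x y)
                                 (cubic_jacobian u v x y)))
   (x%:~R * t + y%:~R * (t ^+ 2 + 2 * u%:~R)).
Proof.
rewrite !root_depressed /cubic_hessian /cubic_jacobian.
move=> /eqP t0; apply/eqP.
have t3 : t ^+ 3 = - (3 * u%:~R * t) - v%:~R.
  by apply/eqP; rewrite -subr_eq0 -t0; apply/eqP; ring.
by ring: t3.
Qed.

(** The pair (p, q) consists of the values of the covariants of the form
x^3 + 3 u x y^2 + v y^3 at a point where the form is a unit. *)
Definition covariants_at_unit (u v p q : int) : Prop :=
  exists x y : int, [/\ (x ^+ 3 + 3 * u * x * y ^+ 2 + v * y ^+ 3) ^+ 2 = 1,
    p = cubic_hessian u v x y & q = cubic_jacobian u v x y].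

(** With s = x t + y (t^2 + 2 u) and e the value of the form at (x, y), Cramer's
rule expresses e t in terms of s and s^2, and the result has the same shape:
e t = (x^2 + u y^2) s - y (s^2 + 2 p).  As e is 1 or -1, the map in the other
direction is thus again an instance of [covariant_root], whose covariants are
u and v because t is the root that it produces. *)
Lemma covariant_equivalent (u v p q : int) :
  covariants_at_unit u v p q ->
  poly_equivalent (depressed p q) (depressed u v).
Proof.
case=> x [y []]; set e := _ + v * y ^+ 3 => e2 -> ->.
set P := cubic_hessian _ _ _ _; set Q := cubic_jacobian _ _ _ _.
have szd r s : (1 < size (depressed r s))%N by rewrite size_depressed.
apply: poly_equivalent_of_roots; rewrite ?depressed_monic //.
  eexists.
  exact: covariant_root (root_intr_qpolyX (szd _ _) (depressed_monic _ _)).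
have inv_p : cubic_hessian P Q (e * (x ^+ 2 + u * y ^+ 2)) (- (e * y)) = u.
  transitivity (u * (e ^+ 2) ^+ 2); last by rewrite e2; ring.
  rewrite /P /Q /cubic_hessian /cubic_jacobian /e.
  ring.
have inv_q : cubic_jacobian P Q (e * (x ^+ 2 + u * y ^+ 2)) (- (e * y)) = v.
  transitivity (v * (e ^+ 2) ^+ 3); last by rewrite e2; ring.
  rewrite /P /Q /cubic_hessian /cubic_jacobian /e.
  ring.
have := covariant_root (e * (x ^+ 2 + u * y ^+ 2)) (- (e * y))
  (root_intr_qpolyX (szd P Q) (depressed_monic _ _)).
rewrite inv_p inv_q.
by eexists; eassumption.
Qed.

(** * The discriminant of a cubic *)

(** The determinant of the n x n matrix with entries M i j, expanded along first
columns.  On a matrix with explicit entries it evaluates to a polynomial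
expression in them. *)
Fixpoint laplace (A : comNzRingType) (n : nat) (M : nat -> nat -> A) : A :=
  if n is n'.+1 then
    foldr (fun i s =>
        (-1) ^+ i * M i 0%N * laplace n' (fun k l => M (bump i k) l.+1) + s)
      0 (iota 0 n)
  else 1.

Lemma det_laplace (A : comNzRingType) (n m : nat) (X : 'M[A]_m)
    (M : nat -> nat -> A) :
  m = n -> (forall i j : 'I_m, X i j = M i j) -> \det X = laplace n M.
Proof.
move=> <- {n} XM; elim: m => [|n IHn] in X M XM *; first by rewrite det_mx00.
pose F i := (-1) ^+ i * M i 0%N * laplace n (fun k l => M (bump i k) l.+1).
transitivity (\sum_(i < n.+1) F i).
  rewrite (expand_det_col _ ord0); apply: eq_bigr => i _.
  rewrite /cofactor XM addn0 mulrCA mulrA; congr (_ * _).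
  by apply: IHn => k l; rewrite !mxE XM.
rewrite -(big_mkord xpredT F) /laplace -/laplace /index_iota subn0.
by elim: (iota 0 n.+1) => [|i s IHs] /=; rewrite ?big_nil ?big_cons ?IHs.
Qed.

Lemma discriminant_cubic (a b c : int) :
  discriminant (Poly [:: c; b; a; 1]) =
  a ^+ 2 * b ^+ 2 - 4 * b ^+ 3 - 4 * a ^+ 3 * c + 18 * a * b * c - 27 * c ^+ 2.
Proof.
have pE : Poly [:: c; b; a; 1] = [:: c; b; a; 1] :> seq int.
  by rewrite (@PolyK _ 0).
have dE : (Poly [:: c; b; a; 1])^`() = Poly [:: b; 2 * a; 3].
  apply/polyP => i; rewrite coef_deriv !coef_Poly.
  by case: i => [|[|[|i]]] //=; rewrite ?nth_nil ?mul0rn //; ring.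
have dE' : Poly [:: b; 2 * a; 3] = [:: b; 2 * a; 3] :> seq int.
  by rewrite (@PolyK _ 0).
pose M (i j : nat) : int := nth 0 (nth [::]
  [:: [:: c; b; a; 1; 0]; [:: 0; c; b; a; 1];
      [:: b; 2 * a; 3; 0; 0]; [:: 0; b; 2 * a; 3; 0];
      [:: 0; 0; b; 2 * a; 3]] i) j.
have -> : discriminant (Poly [:: c; b; a; 1]) = - laplace 5 M.
  rewrite /discriminant /resultant dE.
  set p := Poly _ in pE *; set q := Poly _ in dE' *.
  have sp : size p = 4%N by rewrite pE.
  have sq : size q = 3%N by rewrite dE'.
  have -> : (-1) ^+ 'C((size p).-1, 2) = -1 :> int by rewrite sp.
  rewrite mulN1r; congr (- _).
  apply: det_laplace => [|i j]; first by rewrite sp sq.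
  have: (j < 5)%N by have := ltn_ord j; rewrite {2}sp {2}sq.
  rewrite Sylvester_mxE; move: (nat_of_ord j) => {}j.
  case: splitP => k ->.
    have: (k < 2)%N by have := ltn_ord k; rewrite {2}sq.
    rewrite pE /M; case: (nat_of_ord k) => [|[|]] // _.
      by case: j => [|[|[|[|[|]]]]].
    by case: j => [|[|[|[|[|]]]]].
  have: (k < 3)%N by have := ltn_ord k; rewrite {2}sp.
  rewrite sq dE' /M; case: (nat_of_ord k) => [|[|[|]]] // _.
    by case: j => [|[|[|[|[|]]]]].
    by case: j => [|[|[|[|[|]]]]].
    by case: j => [|[|[|[|[|]]]]].
rewrite /laplace /bump /M /=.
ring.
Qed.

(** * The Z-rank of a cubic of negative discriminant *)

Lemma irreducible_elt_no_root (f : {poly int}) (r : int) :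
  irreducible_elt f -> (2 < size f)%N -> ~~ root f r.
Proof.
move=> [f0 _ f_irr] f_gt2; apply/negP => /factor_theorem[g fE].
have g0 : g != 0 by apply: contraNneq f0; rewrite fE => ->; rewrite mul0r.
have := f_irr _ _ fE.
rewrite !poly_unitE size_XsubC /= => -[/andP[/eqP sg _]|//].
by move: f_gt2; rewrite fE size_mul ?polyXsubC_eq0 // sg size_XsubC.
Qed.

Lemma irreducible_elt_poly (f : {poly int}) :
  irreducible_elt f -> (1 < size f)%N -> irreducible_poly f.
Proof.
move=> [f0 _ f_irr] f_gt1; apply/irreducible_rat_int.
split=> [|d d1 /dvdpP_rat_int[p [a a0 dE]] [r fE]].
  by rewrite size_rat_int_poly.
rewrite dE (eqp_trans (eqp_scale _ a0)) //; move: d1; rewrite dE.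
have [|] := f_irr _ _ fE; rewrite poly_unitE => /andP[/eqP sz1 _].
  by rewrite size_scale // size_rat_int_poly sz1.
move=> _; have /eqP/size_poly1P[c c0 rE] := sz1.
rewrite fE rE mulrC mul_polyC /= linearZ /= eqp_sym.
by rewrite eqp_scale // intr_eq0.
Qed.

(** By Gauss's lemma f is irreducible over the rational numbers, so over them it
divides the representative of x or that of y, which has smaller degree and so
is 0. *)
Lemma qpoly_domain (f : {poly int}) (x y : {poly %/ f}) :
  irreducible_elt f -> (1 < size f)%N -> f \is monic ->
  x * y = 0 -> x = 0 \/ y = 0.
Proof.
move=> f_irr f1 fm xy0; have [k] := poly_of_qpolyM_divE x y f1 fm.
rewrite xy0 addr0 => xyE.
have f_ip := irreducible_elt_poly f_irr f1.
have small (z : {poly %/ f}) : f %| (z : {poly int}) -> z = 0.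
  move=> f_dvd; apply: val_inj => /=; apply: contraTeq f_dvd => z0.
  by rewrite gtNdvdp // -{2}(mk_monicE f1 fm) size_mk_monic.
have f_xy : f %| (x : {poly int}) * y by rewrite xyE dvdp_mulIr.
have [f_x|f_x] := boolP (f %| (x : {poly int})); first by left; apply: small.
right; apply: small; rewrite -(@Gauss_dvdpr _ _ (x : {poly int})) //.
by rewrite irreducible_poly_coprime.
Qed.

(** The norm from Z[X]/(f) to Z, that is the determinant of multiplication,
turns x^2 = d into N(x)^2 = d^3.  The norm is computed with a matrix that has
characteristic polynomial f. *)
Lemma qpoly_sqrt_ge0 (f : {poly int}) (x : {poly %/ f}) (d : int) :
  f \is monic -> (size f = 4)%N -> x ^+ 2 = d%:~R -> 0 <= d.
Proof.
move=> fm f4 xd.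
have [A fA] : exists A : 'M[int]_3, char_poly A = f.
  have := companionmxK fm; move: (companionmx f); rewrite f4 /= => A fA.
  by exists A.
have : horner_mx A x ^+ 2 = d%:M.
  have f1 : (1 < size f)%N by rewrite f4.
  have [k] := poly_of_qpolyM_divE x x f1 fm.
  have -> : x * x = d%:~R by rewrite -expr2.
  move=> xxE.
  have fA0 : horner_mx A f = 0 by rewrite -fA Cayley_Hamilton.
  rewrite expr2 -rmorphM xxE rmorphD rmorphM /= fA0 mulr0 add0r.
  have -> : d%:~R = qpolyC f d by rewrite -[in RHS](intz d) rmorph_int.
  by rewrite /= horner_mx_C.
move/(congr1 determinant); rewrite expr2 det_mulmx det_scalar => detE.
have := sqr_ge0 (\det (horner_mx A x)); rewrite expr2 detE.
by rewrite leNgt exprn_odd_lt0 // -leNgt.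
Qed.

(** In a domain the third root is -a - b, and the product of the differences of
the roots is a square root of the discriminant. *)
Lemma sqrt_discriminant_of_two_roots (B : comNzRingType) (p q : int) (a b : B) :
    (forall x y : B, x * y = 0 -> x = 0 \/ y = 0) ->
    root (map_poly intr (depressed p q)) a ->
    root (map_poly intr (depressed p q)) b -> a != b ->
  exists d : B, d ^+ 2 = (- 27 * (q ^+ 2 + 4 * p ^+ 3))%:~R.
Proof.
move=> B_dom; rewrite !root_depressed => /eqP ra /eqP rb ab.
have pE : 3 * p%:~R = - (a ^+ 2 + a * b + b ^+ 2).
  have /B_dom[ab0|s0] : (a - b) * (a ^+ 2 + a * b + b ^+ 2 + 3 * p%:~R) = 0.
  - transitivity (a ^+ 3 + 3 * p%:~R * a + q%:~R
                  - (b ^+ 3 + 3 * p%:~R * b + q%:~R)); first by ring.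
    by rewrite ra rb subrr.
  - by rewrite (subr0_eq ab0) eqxx in ab.
  - by apply/eqP; rewrite -subr_eq0 opprK addrC s0.
have qE : q%:~R = a * b * (a + b).
  have -> : q%:~R = - (a ^+ 3 + 3 * p%:~R * a).
    by apply/eqP; rewrite -subr_eq0 opprK addrC ra.
  by rewrite pE; ring.
exists ((a - b) * (a + 2 * b) * (2 * a + b)).
transitivity (- 27 * q%:~R ^+ 2 - 4 * (3 * p%:~R) ^+ 3 : B); last by ring.
by rewrite pE qE; ring.
Qed.

Lemma no_three_zeroes_of_disc_lt0 (f : {poly int}) (b c : int) :
  let p := c - b ^+ 2 in let q := 2 * b ^+ 3 - 3 * b * c + f`_0 in
    irreducible_elt f -> f \is monic -> size f = 4%N ->
    f`_2 = 3 * b -> f`_1 = 3 * c -> 0 < q ^+ 2 + 4 * p ^+ 3 ->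
  ~ contains_three_zeroes {poly %/ f} f.
Proof.
move=> p q f_irr fm f4 f2 f1 E_gt0 [x [y [z [xyz /and4P[rx ry _ _]]]]].
have xy : x != y by move: xyz; rewrite /= inE negb_or; case/andP=> /andP[].
have f_gt1 : (1 < size f)%N by rewrite f4.
rewrite (root_depress _ fm f4 f2 f1) in rx.
rewrite (root_depress _ fm f4 f2 f1) in ry.
have dom (s t : {poly %/ f}) := @qpoly_domain f s t f_irr f_gt1 fm.
have [|d dE] := sqrt_discriminant_of_two_roots dom rx ry.
  by rewrite (inj_eq (addIr _)).
have := qpoly_sqrt_ge0 fm f4 dE; rewrite -/p -/q; lia.
Qed.

Lemma free_of_rank_bijection (A : zmodType) r (phi : 'rV[int]_r -> A) :
  zmod_morphism phi -> bijective phi -> free_of_rank A r.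
Proof.
move=> phiB phi_bij.
pose phi_zmod := GRing.isZmodMorphism.Build _ _ phi phiB.
pose psi : {additive 'rV[int]_r -> A} := HB.pack phi phi_zmod.
exists (fun j => psi (delta_mx 0 j)).
apply: (eq_bij phi_bij) => v; rewrite -[phi v]/(psi v).
rewrite {1}[v]row_sum_delta raddf_sum; apply: eq_bigr => j _.
by rewrite -raddfMz -scaler_int intz.
Qed.

Lemma free_of_rank_int : free_of_rank int 1.
Proof.
apply: (@free_of_rank_bijection int 1 (fun v => v 0 0)) => [u v|].
  by rewrite !mxE.
exists (fun a => a%:M) => [v|a]; last by rewrite mxE.
by apply/rowP => i; rewrite !ord1 mxE.
Qed.

(** The products of the powers of X below the degree of h with a basis of A form
a basis of A[X]/(h); row i of the matrix below holds the coordinates of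
coefficient i. *)
Lemma free_of_rank_qpoly (A : comNzRingType) (h : {poly A}) r n :
    h \is monic -> size h = n.+2 ->
  free_of_rank A r -> free_of_rank {poly %/ h} (n.+1 * r).
Proof.
move=> hm hsz [e [ei eK Ke]].
have -> : n.+1 = (size (mk_monic h)).-1 by rewrite mk_monicE ?hsz.
set m := (size _).-1.
pose phi (c : 'rV[int]_r) := \sum_(j < r) e j *~ c 0 j.
have phiB : zmod_morphism phi.
  move=> c d; rewrite /phi -sumrB; apply: eq_bigr => j _.
  by rewrite !mxE mulrzBr.
apply: (@free_of_rank_bijection _ _
  (fun v => rVnpoly (\row_(i < m) phi (row i (vec_mx v))))).
  move=> u v; apply: (can_inj (@npoly_rV_K A m)).
  have npoly_rVB : zmod_morphism (@npoly_rV A m).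
    by move=> y z; rewrite /npoly_rV /= !raddfB.
  rewrite npoly_rVB !rVnpolyK; apply/rowP => i.
  by rewrite !mxE !raddfB /= phiB.
exists (fun z : {poly %/ h} =>
          mxvec (\matrix_(i < m) ei (npoly_rV z 0 i))) => [v|z].
  rewrite rVnpolyK; apply: (canLR vec_mxK); apply/row_matrixP => i.
  by rewrite rowK mxE eK.
rewrite mxvecK; apply: (canLR (@npoly_rV_K _ _)); apply/rowP => i.
by rewrite mxE rowK; apply: Ke.
Qed.

Lemma root_monic_quadratic (A : comNzRingType) (h : {poly A}) (a : A) :
  h \is monic -> size h = 3%N -> root h a -> root h (- h`_1 - a).
Proof.
move=> hm h3; have hE : h = Poly [:: h`_0; h`_1; 1].
  have h2 : h`_2 = 1 by move/monicP: hm; rewrite lead_coefE h3.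
  apply/polyP => i; rewrite coef_Poly; case: i => [|[|[|i]]] //=.
  by rewrite nth_nil nth_default // h3.
have hornerE x : h.[x] = x ^+ 2 + h`_1 * x + h`_0.
  by rewrite [in LHS]hE horner_Poly /=; ring.
by rewrite /root !hornerE => /eqP ha0; apply/eqP; rewrite -[RHS]ha0; ring.
Qed.

(** The ring A_2 is A_1[X]/(f_1) with f_1 of degree 2, so it has rank 2 * 3.  It
contains the roots alpha_1 and alpha_2 of f, and the third root, which is the
other root of f_1.  They are told apart by their coefficients at alpha_2, which
are 0, 1 and -1. *)
Lemma tower_cubic_level2 (f : {poly int}) :
    f \is monic -> size f = 4%N ->
  contains_three_zeroes (stage_ring (tower f 2)) f /\
  free_of_rank (stage_ring (tower f 2)) 6.
Proof.
move=> fm f4.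
pose A := {poly %/ f}; pose al : A := 'qX.
pose fA := map_poly (qpolyC f) f; set f1 := Pdiv.Ring.rdivp fA ('X - al%:P).
have fAm : fA \is monic by rewrite monic_map.
have fA4 : size fA = 4%N by rewrite size_map_poly_id0 // (monicP fm) oner_eq0.
have fAE : fA = f1 * ('X - al%:P).
  rewrite [LHS](Pdiv.RingMonic.rdivp_eq (monicXsubC al)).
  suff /Pdiv.Ring.rmodp_eq0P-> : Pdiv.Ring.rdvdp ('X - al%:P) fA.
    by rewrite addr0.
  by rewrite Pdiv.Ring.rdvdp_XsubCl; apply: root_qpolyX; rewrite ?f4.
have f1m : f1 \is monic by move: fAm; rewrite fAE monicMr ?monicXsubC.
have f13 : size f1 = 3%N.
  move: fA4; rewrite fAE size_Mmonic ?monic_neq0 ?monicXsubC //.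
  by rewrite size_XsubC addn2 => -[].
split; last first.
  have -> : 6%N = (2 * (3 * 1))%N by [].
  apply: (@free_of_rank_qpoly A f1 _ 1) => //.
  by apply: (@free_of_rank_qpoly int f _ 2) => //; apply: free_of_rank_int.
pose B := {poly %/ f1}; pose be : B := 'qX.
pose a1 : B := qpolyC f1 al; pose u : B := qpolyC f1 f1`_1.
have fB : map_poly intr f = map_poly (qpolyC f1) f1 * ('X - a1%:P).
  rewrite (map_poly_intr_qpolyC f1).
  rewrite map_poly_intr_int -/fA [in LHS]fAE rmorphM rmorphB /=.
  by rewrite map_polyX map_polyC.
have root_be : root (map_poly (qpolyC f1) f1) be.
  by apply: root_qpolyX; rewrite ?f13.
have rB x : root (map_poly (qpolyC f1) f1) x -> root (map_poly intr f) x.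
  by rewrite fB => /rootP x0; apply/rootP; rewrite hornerM x0 mul0r.
exists a1, be, (- u - be); split; last first.
  rewrite [all _ _]/= andbT; apply/and3P; split.
  - by apply/rootP; rewrite fB hornerM hornerXsubC subrr mulr0.
  - exact: rB.
  - apply: rB; rewrite /u -coef_map root_monic_quadratic ?monic_map //.
    by rewrite size_map_poly_id0 // (monicP f1m) oner_eq0.
have beE : (be : {poly A}) = 'X by rewrite qpolyXE ?f13.
have coef1_a1 : (a1 : {poly A})`_1 = 0 by rewrite coefC.
have coef1_be : (be : {poly A})`_1 = 1 by rewrite beE coefX.
have coef1_last : (- u - be : {poly A})`_1 = -1.
  by rewrite coefB coefN coef1_be coefC oppr0 sub0r.
have two_A : (1 : A) != - 1.
  apply/eqP => /(congr1 (fun z : A => (z : {poly int})`_0)).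
  by rewrite /= coefN coefC.
have neq1 (x y : B) : (x : {poly A})`_1 != (y : {poly A})`_1 -> x != y.
  by apply: contraNneq => ->.
rewrite /= !inE negb_or andbT -andbA; apply/and3P.
split; apply: neq1; rewrite ?coef1_a1 ?coef1_be ?coef1_last.
- by rewrite eq_sym oner_eq0.
- by rewrite eq_sym oppr_eq0 oner_eq0.
- exact: two_A.
Qed.

Lemma Z_rank_6_of_disc_lt0 (f : {poly int}) (b c : int) :
  let p := c - b ^+ 2 in let q := 2 * b ^+ 3 - 3 * b * c + f`_0 in
    irreducible_elt f -> f \is monic -> size f = 4%N ->
    f`_2 = 3 * b -> f`_1 = 3 * c -> 0 < q ^+ 2 + 4 * p ^+ 3 ->
  Z_rank f 6.
Proof.
move=> p q f_irr fm f4 f2 f1 E_gt0.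
have [three rank6] := tower_cubic_level2 fm f4.
exists 2; split=> //; first by rewrite f4.
case=> [|[|//]] _; last exact: no_three_zeroes_of_disc_lt0 E_gt0.
move=> [x [y [z [_ /andP[]]]]] /=.
have -> : map_poly intr f = f by apply: map_poly_id => t _; rewrite /= intz.
by rewrite (negPf (irreducible_elt_no_root x f_irr _)) // f4.
Qed.

(** * Squares plus cubes that are powers of 3 *)

Lemma mod3P (x : int) :
  exists y, x = 3 * y \/ x = 3 * y + 1 \/ x = 3 * y - 1.
Proof. by exists ((x + 1) %/ 3)%Z; lia. Qed.

Lemma coprimez_3_or_dvd (x : int) : coprimez x 3 \/ exists y, x = 3 * y.
Proof.
have [y [xE|[xE|xE]]] := mod3P x; [by right; exists y|left|left].
- by apply/coprimezP; exists (1, - y) => /=; lia.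
- by apply/coprimezP; exists (-1, y) => /=; lia.
Qed.

Lemma dvd3_cube (x y : int) : x ^+ 3 = 3 * y -> exists z, x = 3 * z.
Proof.
by have [z [->|[->|->]]] := mod3P x => xy; [exists z | exfalso | exfalso]; lia.
Qed.

Lemma dvd3_sqr (x y : int) : x ^+ 2 = 3 * y -> exists z, x = 3 * z.
Proof.
by have [z [->|[->|->]]] := mod3P x => xy; [exists z | exfalso | exfalso]; lia.
Qed.

Lemma odd_pow3 n : exists k : int, 3 ^+ n = 2 * k + 1 :> int.
Proof.
elim: n => [|n [k kE]]; first by exists 0.
by exists (3 * k + 1); rewrite exprS kE; ring.
Qed.

Lemma parity (x : int) : exists k, x = 2 * k \/ x = 2 * k + 1.
Proof. by exists (x %/ 2)%Z; lia. Qed.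

(** A tool for equations over the integers that follow from another equation by
dividing it by c: the last hypothesis is a ring identity. *)
Lemma eq_of_combination (c a b x y : int) :
  a = b -> c != 0 -> c * (x - y) = a - b -> x = y.
Proof.
by move=> -> c0 /eqP; rewrite subrr mulf_eq0 (negPf c0) subr_eq0 => /eqP.
Qed.

(** Modulo 4, the exponent is even, say 3^m = s^2, and q = 2 u + s gives
u (u + s) = (-p)^3.  If u and s are coprime, then u and u + s are cubes x^3
and y^3, and Cardano's formula gives the root -(x + y).  Otherwise 3 divides
p and q, and the equation divided by 9 is q'^2 + 12 p'^3 = s'^2.  Unless
3 | q', this forces s' = 1, and q' = 2 h + 1 gives h (h + 1) = 3 (-p')^3;
one of h and h + 1 is then a cube and the other 3 times a cube. *)
Lemma sqr_plus_cube_eq_pow3 (p q : int) m :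
    q ^+ 2 + 4 * p ^+ 3 = 3 ^+ m ->
  [\/ exists t : int, t ^+ 3 + 3 * p * t + q = 0,
      exists i j, p = 3 * i /\ q = 9 * j |
      covariants_at_unit 0 (-3) p q].
Proof.
move=> pqE; set n := m./2.
have [k kE] := odd_pow3 n; set s := 3 ^+ n in kE.
have sE : q ^+ 2 + 4 * p ^+ 3 = (if odd m then 3 else 1) * s ^+ 2.
  rewrite pqE -{1}(odd_double_half m) exprD -muln2 exprM -/n -/s.
  by case: (odd m); rewrite ?expr1 ?expr0.
have [j jE] := parity q.
have {}sE : q ^+ 2 + 4 * p ^+ 3 = s ^+ 2.
  move: sE; case: (odd m); last by rewrite mul1r.
  by case: jE => ->; rewrite kE => ?; exfalso; lia.
have [u qE] : exists u, q = 2 * u + s.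
  by exists (j - k); move: sE; case: jE => ->; rewrite kE => ?; lia.
have uE : u * (u + s) = (- p) ^+ 3.
  by apply: (@eq_of_combination 4 _ _ _ _ sE) => //; rewrite qE; ring.
have [cop|[sn uq]] : coprimez u s \/ ((0 < n)%N /\ exists z, u = 3 * z).
  have [cop|u3] := coprimez_3_or_dvd u; first by left; rewrite coprimezXr.
  rewrite /s; case: (n) => [|n']; [left | by right].
  by apply/coprimezP; exists (0, 1); rewrite /= mul0r add0r mul1r.
- have cop2 : coprimez u (u + s).
    by have := gcdzMDl 1 u s; rewrite mul1r /coprimez => ->.
  have [x xE] := int_comaximal_product_cube cop2 uE.
  have [y yE] : exists y, u + s = y ^+ 3.
    apply: (@int_comaximal_product_cube _ u (- p)).
      by rewrite coprimez_sym.
    by rewrite mulrC.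
  have pE : x * y = - p by apply: int_cube_inj; rewrite exprMn -xE -yE.
  constructor 1; exists (- (x + y)).
  have -> : p = - (x * y) by rewrite pE opprK.
  have -> : q = x ^+ 3 + y ^+ 3 by rewrite -xE -yE qE; ring.
  by ring.
have [s0 [sS s0E]] : exists s0, s = 3 * s0 /\ s0 = 3 ^+ n.-1.
  by exists (3 ^+ n.-1); rewrite /s -exprS prednK.
have [w {}uq] := uq.
have [q' q'E] : exists q', q = 3 * q' by exists (2 * w + s0); lia.
have [p' p'E] : exists p', p = 3 * p'.
  apply: (@dvd3_cube p (- p ^+ 3 + 3 * s0 ^+ 2 - 3 * q' ^+ 2)).
  by apply: (@eq_of_combination 1 _ _ _ _ sE) => //; rewrite q'E sS; ring.
have [q'3|[q'' q''E]] := coprimez_3_or_dvd q'; last first.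
  by constructor 2; exists p', q''; rewrite q'E q''E; split=> //; ring.
have {}sE : q' ^+ 2 + 12 * p' ^+ 3 = s0 ^+ 2.
  by apply: (@eq_of_combination 9 _ _ _ _ sE) => //; rewrite q'E p'E sS; ring.
have {}sE : q' ^+ 2 + 12 * p' ^+ 3 = 1.
  move: sE; rewrite s0E; case: n.-1 => [|n1]; first by rewrite expr0 expr1n.
  rewrite (exprS 3 n1); move: (3 ^+ n1 : int) => s1 sE.
  have [z zE] : exists z, q' = 3 * z.
    apply: (@dvd3_sqr q' (3 * s1 ^+ 2 - 4 * p' ^+ 3)).
    by apply: (@eq_of_combination 1 _ _ _ _ sE) => //; ring.
  by move/coprimezP: q'3 => [[x y] /=]; rewrite zE; clear; lia.
have [h q'hE] : exists h, q' = 2 * h + 1.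
  have [h [hE|hE]] := parity q'; last by exists h.
  by exfalso; move: sE; rewrite hE; clear; lia.
have hE : h * (h + 1) = 3 * (- p') ^+ 3.
  by apply: (@eq_of_combination 4 _ _ _ _ sE) => //; rewrite q'hE; ring.
suff [x [y [xyE pE qE']]] : exists x y,
    [/\ x ^+ 3 - 3 * y ^+ 3 = 1 \/ x ^+ 3 - 3 * y ^+ 3 = -1,
        x * y = - p' & q' = x ^+ 3 + 3 * y ^+ 3].
  constructor 3; exists (- x), (- y).
  rewrite /cubic_hessian /cubic_jacobian; split.
  - transitivity ((x ^+ 3 - 3 * y ^+ 3) ^+ 2); first by ring.
    by case: xyE => ->.
  - have -> : p = - (3 * (x * y)) by rewrite pE p'E; ring.
    by ring.
  - by rewrite q'E qE'; ring.
have [v [hv|[hv|hv]]] := mod3P h.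
- have vE : v * (3 * v + 1) = (- p') ^+ 3.
    by apply: (@eq_of_combination 3 _ _ _ _ hE) => //; rewrite hv; ring.
  have [x xE] : exists x, 3 * v + 1 = x ^+ 3.
    apply: (@int_comaximal_product_cube _ v (- p')); last by rewrite mulrC.
    by apply/coprimezP; exists (1, -3) => /=; ring.
  have [y yE] : exists y, v = y ^+ 3.
    apply: (@int_comaximal_product_cube _ (3 * v + 1) (- p')) => //.
    by apply/coprimezP; exists (-3, 1) => /=; ring.
  exists x, y; split.
  - by left; rewrite -xE -yE; ring.
  - by apply: int_cube_inj; rewrite exprMn -xE -yE -vE; ring.
  - by rewrite -xE -yE q'hE hv; ring.
- by exfalso; move: hE; rewrite hv; clear; lia.
- have vE : v * (3 * v - 1) = (- p') ^+ 3.
    by apply: (@eq_of_combination 3 _ _ _ _ hE) => //; rewrite hv; ring.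
  have [x xE] : exists x, 3 * v - 1 = x ^+ 3.
    apply: (@int_comaximal_product_cube _ v (- p')); last by rewrite mulrC.
    by apply/coprimezP; exists (-1, 3) => /=; ring.
  have [y yE] : exists y, v = y ^+ 3.
    apply: (@int_comaximal_product_cube _ (3 * v - 1) (- p')) => //.
    by apply/coprimezP; exists (3, -1) => /=; ring.
  exists x, y; split.
  - by right; rewrite -xE -yE; ring.
  - by apply: int_cube_inj; rewrite exprMn -xE -yE -vE; ring.
  - by rewrite -xE -yE q'hE hv; ring.
Qed.

Lemma coprimez_norm_eq (q r : int) m :
  q ^+ 2 + 3 ^+ m = 4 * r ^+ 3 -> coprimez q 3 -> coprimez q r.
Proof.
move=> qrE q3; have : coprimez q (3 ^+ m) by rewrite coprimezXr.
move: (3 ^+ m : int) qrE => z qrE /coprimezP[[x y] /= xy1].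
apply/coprimezP; exists (x - y * q, 4 * y * r ^+ 2) => /=.
transitivity (x * q + y * (4 * r ^+ 3 - q ^+ 2)); first by ring.
by rewrite -qrE [q ^+ 2 + z]addrC addrK.
Qed.

(** Modulo 4, the exponent is odd, and with s = 3^((m-1)/2) the equation becomes
q^2 + 3 s^2 = 4 (-p)^3, to which [four_cubes_norm] applies when 3 does not
divide q.  There, 3 | s would imply 3 | a^3 - 3 a^2 b + b^3, hence 3 | a + b and
then 3 | q; so s = 1.  If 3 | q, dividing out the powers of 3 leads to
3 q''^2 + 4 p'^3 = -s0^2 with q = 9 q'' and p = 3 p'.  If 3 | s0, then 3
divides p' and q'' too, and otherwise s0 = 1, where [four_cubes_norm] applies
to 1 + 3 q''^2 = 4 (-p')^3, with the roles of q and s exchanged. *)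
Lemma sqr_plus_cube_eq_opp_pow3 (p q : int) m :
    q ^+ 2 + 4 * p ^+ 3 = - 3 ^+ m ->
  [\/ exists t : int, t ^+ 3 + 3 * p * t + q = 0,
      exists i j, p = 9 * i /\ q = 27 * j,
      covariants_at_unit (-1) 1 p q |
      covariants_at_unit (-3) 9 p q].
Proof.
move=> pqE; set n := m./2.
have [k kE] := odd_pow3 n; set s : int := 3 ^+ n in kE.
have mE : 3 ^+ m = (if odd m then 3 else 1) * s ^+ 2.
  rewrite -[in LHS](odd_double_half m) exprD -muln2 exprM -/n -/s.
  by case: (odd m); rewrite ?expr1 ?expr0.
have m_odd : odd m.
  move: pqE; rewrite mE; case: (odd m) => //; rewrite kE.
  by have [j [->|->]] := parity q; clear; lia.
rewrite m_odd /= in mE.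
have sE : q ^+ 2 + 3 * s ^+ 2 = 4 * (- p) ^+ 3.
  by rewrite mE in pqE; apply: (@eq_of_combination 1 _ _ _ _ pqE) => //; ring.
have [q3|[q' q'E]] := coprimez_3_or_dvd q.
- have cop : coprimez q (- p) by apply: (@coprimez_norm_eq _ _ m); rewrite ?mE.
  have [a [b [pE [qE|[qE sE2]]]]] := four_cubes_norm sE cop.
    constructor 1; exists (b - 2 * a); rewrite qE.
    have -> : p = - (a ^+ 2 - a * b + b ^+ 2) by rewrite -pE opprK.
    by ring.
  (* Cardano's formula gives the root -(d + d'), where d = z (a + b w) with
     z^3 = w and d' is the conjugate of d.  In terms of t = z + 1/z, which is a
     root of X^3 - 3 X + 1, this root is (b - a) t + b (t^2 - 2). *)
  constructor 3; exists (b - a), b.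
  rewrite /cubic_hessian /cubic_jacobian; split.
  + transitivity ((a ^+ 3 - 3 * a ^+ 2 * b + b ^+ 3) ^+ 2); first by ring.
    transitivity (s ^+ 2); first by case: sE2 => ->; ring.
    have [n0|n_gt0] := posnP n; first by rewrite /s n0.
    have [t st] : exists t, s = 3 * t.
      by exists (3 ^+ n.-1); rewrite /s -exprS prednK.
    have [c abE] : exists c, a + b = 3 * c.
      case: sE2; rewrite st => sE2.
        apply: (@dvd3_cube _ (a * b ^+ 2 + 2 * a ^+ 2 * b + t)).
        by apply: (@eq_of_combination (-1) _ _ _ _ sE2) => //; ring.
      apply: (@dvd3_cube _ (a * b ^+ 2 + 2 * a ^+ 2 * b - t)).
      by apply: (@eq_of_combination 1 _ _ _ _ sE2) => //; ring.
    exfalso; move/coprimezP: q3 => [[x y] /=]; rewrite qE.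
    rewrite (_ : a = 3 * c - b); last by rewrite -abE addrK.
    by clear; lia.
  + by rewrite -[p]opprK pE; ring.
  + by rewrite qE; ring.
have [p' p'E] : exists p', p = 3 * p'.
  apply: (@dvd3_cube p (- p ^+ 3 - s ^+ 2 - 3 * q' ^+ 2)).
  by apply: (@eq_of_combination 1 _ _ _ _ sE) => //; rewrite q'E; ring.
have {}sE : s ^+ 2 = 3 * (- q' ^+ 2 - 12 * p' ^+ 3).
  by apply: (@eq_of_combination 3 _ _ _ _ sE) => //; rewrite q'E p'E; ring.
have n_gt0 : (0 < n)%N.
  rewrite lt0n; apply/eqP => n0; move: sE; rewrite /s n0 expr0 expr1n.
  by clear; lia.
have [s0 [sS s0E]] : exists s0, s = 3 * s0 /\ s0 = 3 ^+ n.-1.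
  by exists (3 ^+ n.-1); rewrite /s -exprS prednK.
have [q'' q''E] : exists q'', q' = 3 * q''.
  apply: (@dvd3_sqr q' (- s0 ^+ 2 - 4 * p' ^+ 3)).
  by apply: (@eq_of_combination 3 _ _ _ _ sE) => //; rewrite sS; ring.
have {}sE : 3 * q'' ^+ 2 + 4 * p' ^+ 3 = - s0 ^+ 2.
  by apply: (@eq_of_combination 9 _ _ _ _ sE) => //; rewrite sS q''E; ring.
have [s01|[s1 s1E]] : s0 = 1 \/ exists s1, s0 = 3 * s1.
  rewrite s0E; case: n.-1 => [|n1]; first by left.
  by right; exists (3 ^+ n1); rewrite exprS.
- have {}sE : 1 ^+ 2 + 3 * q'' ^+ 2 = 4 * (- p') ^+ 3.
    by apply: (@eq_of_combination 1 _ _ _ _ sE) => //; rewrite s01; ring.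
  have cop1 : coprimez 1 (- p') by rewrite /coprimez gcd1z.
  have [a [b [pE [abE|[abE q''ab]]]]] := four_cubes_norm sE cop1.
    (* One of the three factors of 1 would be even. *)
    exfalso; have [i iE] := parity a; have [j jE] := parity b.
    by case: iE abE => ->; case: jE => ->; clear; lia.
  have p_ab : p = - 3 * (a ^+ 2 - a * b + b ^+ 2) by rewrite -pE p'E; ring.
  pose g := (a + b) ^+ 3 - 9 * (a + b) * b ^+ 2 + 9 * b ^+ 3.
  have g1 : g = -1 by rewrite /g [in RHS]abE; ring.
  (* The substitution of a - b for a removes the quadratic term of
     a^3 + 3 a^2 b - 6 a b^2 + b^3. *)
  constructor 4; case: q''ab => q''ab;
    [exists (a + b), b | exists (- (a + b)), (- b)].
    rewrite /cubic_hessian /cubic_jacobian; split.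
    + by transitivity (g ^+ 2); [rewrite /g; ring | rewrite g1].
    + by rewrite p_ab; ring.
    + by rewrite q'E q''E q''ab; ring.
  rewrite /cubic_hessian /cubic_jacobian; split.
  + by transitivity (g ^+ 2); [rewrite /g; ring | rewrite g1].
  + by rewrite p_ab; ring.
  + by rewrite q'E q''E q''ab; ring.
- have [p'' p''E] : exists p'', p' = 3 * p''.
    apply: (@dvd3_cube p' (- q'' ^+ 2 - p' ^+ 3 - 3 * s1 ^+ 2)).
    by apply: (@eq_of_combination 1 _ _ _ _ sE) => //; rewrite s1E; ring.
  have [r rE] : exists r, q'' = 3 * r.
    apply: (@dvd3_sqr q'' (- s1 ^+ 2 - 12 * p'' ^+ 3)).
    by apply: (@eq_of_combination 3 _ _ _ _ sE) => //; rewrite s1E p''E; ring.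
  by constructor 2; exists p'', r; rewrite p'E p''E q'E q''E rE; split; ring.
Qed.

(** * The classification *)

Lemma cube_XsubC (a : int) :
  ('X - a%:P) ^+ 3 = Poly [:: - a ^+ 3; 3 * a ^+ 2; - (3 * a); 1].
Proof. by rewrite /= !cons_poly_def; ring. Qed.

Lemma triple_zero_mod_depressed (f : {poly int}) (b c m : int) :
  let p := c - b ^+ 2 in let q := 2 * b ^+ 3 - 3 * b * c + f`_0 in
    f \is monic -> size f = 4%N -> f`_2 = 3 * b -> f`_1 = 3 * c ->
    (m %| 3 * p)%Z -> (m %| q)%Z -> triple_zero_mod f m.
Proof.
move=> p q fm f4 f2 f1 mp mq; exists (- b) => i; apply/eqP.
have -> : f`_i = (Poly [:: f`_0; f`_1; f`_2; 1])`_i by rewrite -(cubicE fm f4).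
rewrite eqz_mod_dvd cube_XsubC !coef_Poly.
case: i => [|[|[|[|i]]]] /=; rewrite ?nth_nil ?subrr ?dvdz0 //.
- rewrite (_ : _ - _ = 3 * p * b + q); last by rewrite /p /q; ring.
  by apply: rpredD mq; apply: dvdz_mulr.
- by rewrite f1 (_ : _ - _ = 3 * p) // /p; ring.
- by rewrite f2 (_ : _ - _ = 0) ?dvdz0 //; ring.
Qed.

Theorem theorem5p1 (f : {poly int})
    (f_monic : f \is monic) (f_cubic : size f = 4%N)
    (f_irr : irreducible_elt f)
    (f_disc : exists k : nat,
       discriminant f = 3 ^+ k \/ discriminant f = - 3 ^+ k)
    (f_mod3 : triple_zero_mod f 3)
    (f_mod27 : ~ triple_zero_mod f 27)
    (f_rank6 : Z_rank f 6 -> ~ triple_zero_mod f 9) :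
  [\/ poly_equivalent f ('X^3 - 3%:P),
      poly_equivalent f ('X^3 - 3%:P * 'X + 1) |
      poly_equivalent f ('X^3 - 9%:P * 'X + 9%:P)].
Proof.
have [b f2] : exists b, f`_2 = 3 * b.
  have [a /(_ 2)] := f_mod3; rewrite cube_XsubC coef_Poly /= => /eqP.
  by rewrite eqz_mod_dvd => /dvdzP[k kE]; exists (k - a);
    rewrite mulrBr [3 * k]mulrC -kE; ring.
have [c f1] : exists c, f`_1 = 3 * c.
  have [a /(_ 1)] := f_mod3; rewrite cube_XsubC coef_Poly /= => /eqP.
  by rewrite eqz_mod_dvd => /dvdzP[k kE]; exists (k + a ^+ 2);
    rewrite mulrDr [3 * k]mulrC -kE; ring.
set p := c - b ^+ 2; set q := 2 * b ^+ 3 - 3 * b * c + f`_0.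
have discE : discriminant f = - 27 * (q ^+ 2 + 4 * p ^+ 3).
  rewrite [f in LHS](cubicE f_monic f_cubic) discriminant_cubic f2 f1 /p /q.
  by ring.
have no_root t : t ^+ 3 + 3 * p * t + q <> 0.
  move=> t0; have := irreducible_elt_no_root (t - b) f_irr.
  have map_id : map_poly intr f = f.
    by apply: map_poly_id => x _; rewrite /= intz.
  rewrite -{2}map_id (root_depress _ f_monic f_cubic f2 f1).
  by rewrite root_depressed f_cubic !intz subrK -/p -/q t0 eqxx => /(_ isT).
have f_equiv u v :
    covariants_at_unit u v p q -> poly_equivalent f (depressed u v).
  move=> /covariant_equivalent; apply: poly_equivalent_trans.
  exact: depress_equivalent.
have not_mod27 : ~ exists i j, p = 9 * i /\ q = 27 * j.
  move=> [i [j [pE qE]]]; apply: f_mod27.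
  apply: (triple_zero_mod_depressed f_monic f_cubic f2 f1).
    by rewrite -/p pE (_ : 3 * _ = 27 * i) ?dvdz_mulr //; ring.
  by rewrite -/q qE dvdz_mulr.
have [m [qpE|qpE]] : exists m,
    q ^+ 2 + 4 * p ^+ 3 = 3 ^+ m \/ q ^+ 2 + 4 * p ^+ 3 = - 3 ^+ m.
  have [k kE] := f_disc; rewrite discE in kE.
  (* Since 27 divides the discriminant. *)
  have k3 : (3 <= k)%N.
    case: k kE => [|[|[|k]]] //; rewrite ?expr0 ?expr1 ?expr2; lia.
  exists (k - 3)%N.
  move: kE; rewrite -{1 2}(subnK k3) exprD.
  move: (3 ^+ (k - 3) : int) => z; lia.
- have Z6 : Z_rank f 6.
    apply: (Z_rank_6_of_disc_lt0 f_irr f_monic f_cubic f2 f1).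
    by rewrite -/p -/q qpE exprn_gt0.
  have [[t t0]|[i [j [pE qE]]]|/f_equiv f_eq] := sqr_plus_cube_eq_pow3 qpE.
  + by have := no_root t t0.
  + case: (f_rank6 Z6).
    apply: (triple_zero_mod_depressed f_monic f_cubic f2 f1).
      by rewrite -/p pE (_ : 3 * _ = 9 * i) ?dvdz_mulr //; ring.
    by rewrite -/q qE dvdz_mulr.
  + constructor 1; suff <- : depressed 0 (-3) = 'X^3 - 3%:P by [].
    by rewrite /depressed; ring.
- have [[t t0]|?|/f_equiv f_eq|/f_equiv f_eq] := sqr_plus_cube_eq_opp_pow3 qpE.
  + by have := no_root t t0.
  + by [].
  + constructor 2; suff <- : depressed (-1) 1 = 'X^3 - 3%:P * 'X + 1 by [].
    by rewrite /depressed; ring.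
  + constructor 3; suff <- : depressed (-3) 9 = 'X^3 - 9%:P * 'X + 9%:P by [].
    by rewrite /depressed; ring.
Qed.
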